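(* Let $(E,\Psi,H)\to M$ be a level-one $N$-iterated sphere bundle with a left transgressive generating set $\Psi=\{\psi_1,\dots,\psi_N\}$ and a level-one closed form $H$ of a fixed odd degree in the transgressive complex of $E$, representing an integral cohomology class. If $(\hat E,\hat\Psi,\hat H)\to M$ is any reverse dual of $(E,\Psi,H)$, then $(\hat E,\hat\Psi,\hat H)$ is a (transgressive level-two) T-dual of $(E,\Psi,H)$. If moreover the reverse dual is unimodular, then $(\hat E,\hat\Psi,\hat H)$ is a unimodular T-dual of $(E,\Psi,H)$.
   Context: Iterated sphere bundle: manifolds $E_0=M,E_1,\dots,E_N=E$ such that each $E_j\to E_{j-1}$ is an oriented sphere bundle with odd-dimensional fibre $S^{2n_j-1}$. We work with differential forms. A transgressive generating set $\Psi=\{\psi_1,\dots,\psi_N\}$ consists of global angular forms: $\psi_j$ is a form of degree $2n_j-1$ on $E_j$ with integral $1$ over the fibres of $E_j\to E_{j-1}$, and $d\psi_j$ is (the pullback of) a form representing the Euler class of $E_j\to E_{j-1}$ which lies in $\wedge\langle\psi_1,\dots,\psi_{j-1}\rangle\otimes\Omega^\bullet(M)$. The transgressive complex is $\Omega_\Psi(E)=\wedge\langle\psi_1,\dots,\psi_N\rangle\otimes\Omega^\bullet(M)\subset\Omega^\bullet(E)$ (pullbacks omitted); an element has transgressive level $i$ if it lies in $\wedge^{\le i}\langle\psi_1,\dots,\psi_N\rangle\otimes\Omega^\bullet(M)$. The bundle is level-one if all $d\psi_j$ have transgressive level one. Massey product matrices: with $\psi_0=1$, the left matrix $A=(a^i_j)_{0\le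 i,j\le N+1}$ of $(E,\Psi,H)$ is the strictly upper triangular matrix of forms on $M$ with $$d\psi_j=\sum_{i=0}^{j-1}\psi_i a^i_j\ (1\le j\le N),\qquad H=\sum_{i=0}^N\psi_i a^i_{N+1}.$$ With $\hat\psi^0=1$, the right matrix $\hat A=(\hat a^i_j)_{0\le i,j\le N+1}$ of $(\hat E,\hat\Psi,\hat H)$, $\hat\Psi=\{\hat\psi^1,\dots,\hat\psi^N\}$, is the strictly upper triangular matrix of forms on $M$ with $$d\hat\psi^j=\sum_{i=0}^{j-1}\hat a^{N+1-j}_{N+1-i}\hat\psi^i\ (1\le j\le N),\qquad \hat H=\sum_{i=0}^N\hat a^0_{N+1-i}\hat\psi^i.$$ Reverse dual: two level-one $N$-iterated sphere bundles over a common base $M$ with transgressive generating sets and level-one closed odd forms, $(E,\Psi,H)$ and $(\hat E,\hat\Psi,\hat H)$, are reverse duals if there is an invertible diagonal matrix $P=\mathrm{diag}(1,\lambda_1,\dots,\lambda_N,1)$, $\lambda_i\in\mathbb R$, with $\hat A=P^{-1}AP$. They are unimodular reverse duals if one can take all $\lambda_i=\pm1$. T-duality: two level-one $N$-iterated sphere bundles $(E,\Psi,H)$ and $(\hat E,\hat\Psi,\hat H)$ over a common base $M$, with transgressive generating sets $\Psi=\{\psi_1,\dots,\psi_N\}$ and $\hat\Psi=\{\hat\psi^1,\dots,\hat\psi^N\}$ and level-one closed odd forms $H\in\Omega_\Psi(E)$ and $\hat H\in\Omega_{\hat\Psi}(\hat E)$, form a transgressive level-two T-dual pair if there is a form $F\in\Omega_{\Psi\cup\hat\Psi}(E\times_M\hat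 E)=\wedge\langle\psi_1,\dots,\psi_N,\hat\psi^1,\dots,\hat\psi^N\rangle\otimes\Omega^\bullet(M)$ of transgressive level two (i.e. in $\wedge^{\le2}\langle\Psi\cup\hat\Psi\rangle\otimes\Omega^\bullet(M)$) such that (gerbe trivialization) $dF=p^*H-\hat p^*\hat H$, where $p,\hat p$ are the projections of $E\times_M\hat E$ to $E$ and $\hat E$; and (nondegeneracy) the bilinear map $\langle\Psi\rangle^*\times\langle\hat\Psi\rangle^*\to\mathbb R$, $(v,\hat v)\mapsto F(v,\hat v)$, is nondegenerate. Here $F(v,\hat v)$ is obtained by contraction, i.e. the matrix of the bilinear map in the bases dual to $\Psi$, $\hat\Psi$ is given by the degree-zero parts of the coefficients of $\psi_i\hat\psi^k$ in $F$. The T-dual pair is unimodular if this bilinear form is unimodular (integral matrix of determinant $\pm1$ in the bases dual to $\Psi$ and $\hat\Psi$). *)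

(* Defs.v *)
From HB Require Import structures.
From mathcomp Require Import all_boot all_order all_algebra.
From mathcomp Require Import all_classical all_reals all_analysis.

Set Implicit Arguments.
Unset Strict Implicit.
Unset Printing Implicit Defensive.

Import Order.TTheory GRing.Theory Num.Theory.
Import numFieldNormedType.Exports.

Local Open Scope ring_scope.

Definition partial (R : realType) n (i : 'I_n) (f : 'rV[R]_n -> R)
  (x : 'rV[R]_n) : R := 'D_(delta_mx 0 i) f x.

(* Meant for open [U]. *)
Fixpoint Ck_on (R : realType) n (k : nat) (U : set 'rV[R]_n)
    (f : 'rV[R]_n -> R) : Prop :=
  (forall x, U x -> {for x, continuous f}) /\
  match k with
  | 0 => True
  | k'.+1 => forall i : 'I_n,
      (forall x, U x -> derivable f x (delta_mx 0 i)) /\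
      Ck_on k' U (partial i f)
  end.

Definition smooth_on (R : realType) n (U : set 'rV[R]_n)
  (f : 'rV[R]_n -> R) : Prop := forall k, Ck_on k U f.

Definition smooth_map_on (R : realType) n m (U : set 'rV[R]_n)
  (f : 'rV[R]_n -> 'rV[R]_m) : Prop :=
  forall j : 'I_m, smooth_on U (fun x => f x 0 j).

Fixpoint iint (R : realType) n : ('rV[R]_n -> R) -> R :=
  match n return ('rV[R]_n -> R) -> R with
  | 0 => fun f => f 0
  | n'.+1 => fun f => \int[lebesgue_measure]_t
      iint (fun y : 'rV[R]_n' => f (row_mx (t%:M : 'rV[R]_1) y))
  end.

(* An element [a] of the exterior algebra of (R^n)^*: [a S] is the coefficient
   of the increasing product of the dx_i, i in S. *)
Definition ext (R : realType) n := {set 'I_n} -> R.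

(* The sign with dx_I dx_J = esign I J dx_(I u J), for disjoint I and J. *)
Definition esign (R : realType) n (I J : {set 'I_n}) : R :=
  (-1) ^+ #|[pred ij : 'I_n * 'I_n |
              [&& ij.1 \in I, ij.2 \in J & (ij.2 < ij.1)%N]]|.

Definition ewedge (R : realType) n (a b : ext R n) : ext R n :=
  fun K => \sum_(I : {set 'I_n} | I \subset K)
             esign R I (K :\: I) * a I * b (K :\: I).

Definition eone (R : realType) n : ext R n := fun K => (K == finset.set0)%:R.

Definition edfun (R : realType) n (f : 'rV[R]_n -> R) (x : 'rV[R]_n) :
  ext R n := fun K => \sum_(i < n | K == [set i]%SET) partial i f x.

(* (g^* w)(x), where [w] is the value of a form at [g x]:
   g^* dx_I is the product of the dg_i, i in I. *)
Definition epull (R : realType) m n (g : 'rV[R]_m -> 'rV[R]_n) (w : ext R n)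
    (x : 'rV[R]_m) : ext R m :=
  fun K => \sum_(I : {set 'I_n}) w I *
    (\big[@ewedge R m / @eone R m]_(i in I) edfun (fun y => g y 0 i) x) K.

(* A chart is recorded by its inverse, a global parametrization
   R^m -> M of an open subset. *)
Record manifold (R : realType) := Manifold {
  mpt :> topologicalType;
  mdim : nat;
  atlas : set ('rV[R]_mdim -> mpt);
  mfd_hausdorff : hausdorff_space mpt;
  mfd_countable : @second_countable mpt;
  chart_inj : forall s, atlas s -> injective s;
  chart_cont : forall s, atlas s -> continuous s;
  chart_open : forall s, atlas s ->
    forall U : set 'rV[R]_mdim, open U -> open (s @` U)%classic;
  chart_cover : forall x : mpt, exists2 s, atlas s & range s x;
  chart_smooth : forall s t, atlas s -> atlas t ->
    forall g : 'rV[R]_mdim -> 'rV[R]_mdim,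
    (forall x, range t (s x) -> t (g x) = s x) ->
    smooth_map_on (s @^-1` range t)%classic g
}.

Definition plot (R : realType) (M : manifold R) n : set ('rV[R]_n -> M) :=
  fun p => continuous p /\
    forall (t : 'rV[R]_(mdim M) -> M) (g : 'rV[R]_n -> 'rV[R]_(mdim M)),
    atlas t -> (forall x, range t (p x) -> t (g x) = p x) ->
    smooth_map_on (p @^-1` range t)%classic g.

Definition smooth_mfd_map (R : realType) (M N : manifold R) (f : M -> N) :=
  forall n (p : 'rV[R]_n -> M), plot p -> plot (f \o p).

(* A (possibly inhomogeneous) form on a space with plots is a family of forms
   on the R^n, one for each plot, compatible with reparametrization; on a
   manifold this is the same as a differential form in the usual sense, the
   member of the family at [p] being the pullback by [p]. Since R^n is
   diffeomorphic to a ball, plots defined on the whole of R^n suffice.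
   A family is only meaningful at plots, so families are compared with
   [eqon]. *)

Definition plots (R : realType) (T : Type) := forall n, set ('rV[R]_n -> T).

Definition formfam (R : realType) (T : Type) :=
  forall n, ('rV[R]_n -> T) -> 'rV[R]_n -> ext R n.

Definition is_form (R : realType) (T : Type) (D : plots R T)
    (w : formfam R T) : Prop :=
  (forall n (p : 'rV[R]_n -> T), D n p ->
    forall K, smooth_on setT (fun x => w n p x K)) /\
  (forall m n (p : 'rV[R]_n -> T) (g : 'rV[R]_m -> 'rV[R]_n), D n p ->
    smooth_map_on setT g ->
    forall x, w m (p \o g) x = epull g (w n p (g x)) x).

Definition eqon (R : realType) (T : Type) (D : plots R T)
    (w w' : formfam R T) : Prop :=
  forall n (p : 'rV[R]_n -> T), D n p -> forall x, w n p x = w' n p x.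

Section FormOperations.
Variables (R : realType) (T : Type).
Implicit Types w : formfam R T.

Definition fzero : formfam R T := fun _ _ _ _ => 0.
Definition fone : formfam R T := fun _ _ _ => @eone R _.
Definition fsub w w' : formfam R T := fun n p x K => w n p x K - w' n p x K.
Definition fscale (c : R) w : formfam R T := fun n p x K => c * w n p x K.
Definition fwedge w w' : formfam R T :=
  fun n p x => ewedge (w n p x) (w' n p x).
Definition fsum (I : finType) (P : pred I) (w : I -> formfam R T) :
  formfam R T := fun n p x K => \sum_(i | P i) w i n p x K.

(* d w = sum_i dx_i (partial_i w) *)
Definition fd w : formfam R T := fun n p x K =>
  \sum_(i in K) esign R [set i]%SET (K :\ i)%SET *
    partial i (fun y => w n p y (K :\ i)%SET) x.

Definition pull (T' : Type) (f : T -> T') (w : formfam R T') : formfam R T :=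
  fun n p => w n (f \o p).

Definition homogeneous (D : plots R T) (k : nat) w : Prop :=
  forall n (p : 'rV[R]_n -> T), D n p -> forall x (K : {set 'I_n}),
    #|K| != k -> w n p x K = 0.

Definition odd_form (D : plots R T) w : Prop :=
  forall n (p : 'rV[R]_n -> T), D n p -> forall x (K : {set 'I_n}),
    ~~ odd #|K| -> w n p x K = 0.

Definition closed_form (D : plots R T) w : Prop := eqon D (fd w) fzero.

End FormOperations.

Definition simplex (R : realType) n : set 'rV[R]_n :=
  fun y => (forall i, 0 <= y 0 i) /\ \sum_i y 0 i <= 1.

Definition bary (R : realType) n (y : 'rV[R]_n) (k : 'I_n.+1) : R :=
  if unlift ord0 k is Some j then y 0 j else 1 - \sum_j y 0 j.

Definition face (R : realType) n (i : 'I_n.+2) (y : 'rV[R]_n) :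
    'rV[R]_n.+1 :=
  \row_j (if unlift i (lift ord0 j) is Some k then bary y k else 0).

(* The chain is sum_j a_j s_j. Smooth maps on the standard simplex are
   represented by smooth extensions to R^n, so singular simplices are compared
   on the standard simplex only; the sum in [is_cycle] is the coefficient of
   [t] in the boundary. *)
Definition is_cycle (R : realType) (T : Type) n r (a : 'I_r -> int)
    (s : 'I_r -> 'rV[R]_n.+1 -> T) : Prop :=
  forall t : 'rV[R]_n -> T,
    \sum_(j < r) \sum_(i < n.+2 |
        `[< forall y, simplex y -> s j (face i y) = t y >]) (-1) ^+ i * a j = 0.

Definition period (R : realType) (T : Type) n (w : formfam R T)
    (s : 'rV[R]_n -> T) : R :=
  iint (fun y => \1_(@simplex R n) y * w n s y [set: 'I_n]%SET).

(* The class of the closed form [w] of degree n+1 is in the image of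
   H^(n+1)(M; Z) -> H^(n+1)(M; R). *)
Definition integral_class (R : realType) (M : manifold R) n
    (w : formfam R M) : Prop :=
  forall r (a : 'I_r -> int) (s : 'I_r -> 'rV[R]_n.+1 -> M),
    (forall j, plot (s j)) -> is_cycle a s ->
    \sum_(j < r) (a j)%:~R * period w (s j) \is a Num.int.

Definition enorm (R : realType) n (y : 'rV[R]_n) : R :=
  Num.sqrt (\sum_i y 0 i ^+ 2).

Definition sphere (R : realType) k : set 'rV[R]_k.+1 :=
  fun y => enorm y = 1.

(* [s] identifies q^-1(U) with U x S^k, fibrewise and smoothly. *)
Definition trivialization (R : realType) (B E : manifold R) (q : E -> B) k
    (U : set B) (s : E -> 'rV[R]_k.+1) : Prop :=
  [/\ open U,
      forall e, U (q e) -> sphere (s e),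
      forall b y, U b -> sphere y -> exists! e, q e = b /\ s e = y
    & forall n (u : 'rV[R]_n -> E), (forall z, U (q (u z))) ->
        (plot u <-> plot (q \o u) /\ smooth_map_on setT (s \o u))].

(* Over each common point, the transition diffeomorphism of S^k preserves the
   orientation. Here [h] is the fibre parametrization inverse to [s], extended
   by h y = h (y / |y|), and y |-> |y| t (h y) is the radial extension of the
   transition to the complement of the origin. *)
Definition same_orientation (R : realType) (B E : manifold R) (q : E -> B) k
    (U V : set B) (s t : E -> 'rV[R]_k.+1) : Prop :=
  forall (b : B) (h : 'rV[R]_k.+1 -> E), U b -> V b ->
    (forall y, y != 0 -> q (h y) = b /\ s (h y) = (enorm y)^-1 *: y) ->
    forall y, y != 0 ->
    0 < \det (\matrix_(i < k.+1, j < k.+1)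
                partial i (fun z => (enorm z *: t (h z)) 0 j) y).

Record sphere_bundle (R : realType) (k : nat) (B E : manifold R) :=
  SphereBundle {
  sb_proj :> E -> B;
  sb_triv : set (set B * (E -> 'rV[R]_k.+1));
  sb_smooth : smooth_mfd_map sb_proj;
  sb_trivP : forall U s, sb_triv (U, s) -> trivialization sb_proj U s;
  sb_cover : forall b : B, exists U s, sb_triv (U, s) /\ U b;
  sb_oriented : forall U V s t, sb_triv (U, s) -> sb_triv (V, t) ->
    same_orientation sb_proj U V s t
}.

(* Inverse stereographic projection R^k -> S^k from (-1, 0, ..., 0). It is
   compatible with the orientation of S^k as the boundary of the ball. *)
Definition stereo (R : realType) k (y : 'rV[R]_k) : 'rV[R]_k.+1 :=
  (1 + enorm y ^+ 2)^-1 *: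
    row_mx ((1 - enorm y ^+ 2)%:M : 'rV[R]_1) (2 *: y).

(* The fibre minus one point is parametrized by [h]. *)
Definition fibre_integral_one (R : realType) k (B E : manifold R)
    (q : sphere_bundle k B E) (w : formfam R E) : Prop :=
  forall U s b (h : 'rV[R]_k -> E), sb_triv q (U, s) -> U b ->
    (forall y, q (h y) = b /\ s (h y) = stereo y) ->
    iint (fun y => w k h y [set: 'I_k]%SET) = 1.

Definition global_angular_form (R : realType) k (B E : manifold R)
    (q : sphere_bundle k B E) (w : formfam R E) : Prop :=
  [/\ is_form (@plot R E) w, homogeneous (@plot R E) k w
    & fibre_integral_one q w].

(* The Euler class of an oriented sphere bundle is the transgression of the
   fibre class (with the sign convention d psi = + q^* e). *)
Definition represents_euler_class (R : realType) k (B E : manifold R)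
    (q : sphere_bundle k B E) (e : formfam R B) : Prop :=
  [/\ is_form (@plot R B) e, homogeneous (@plot R B) k.+1 e,
      closed_form (@plot R B) e
    & exists2 w, global_angular_form q w &
        eqon (@plot R E) (fd w) (pull q e)].

(* E_0 = M, E_1, ..., E_N = E; the fibres are S^k with k = 2n - 1, n >= 1. *)
Inductive tower (R : realType) (M : manifold R) : nat -> manifold R -> Type :=
| tower0 : tower M 0 M
| towerS N (B E : manifold R) k of tower M N B & odd k & sphere_bundle k B E :
    tower M N.+1 E.

Fixpoint tower_proj (R : realType) (M : manifold R) N (E : manifold R)
    (T : tower M N E) : E -> M :=
  match T in tower _ _ E return E -> M with
  | tower0 => id
  | towerS _ _ _ _ T' _ q => tower_proj T' \o q
  end.

(* sum_S g_S b^*(c_S), where g_S is the increasing product of the g_i, i in S: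
   the image in the forms on [T] of an element of wedge<g> (x) Omega(M). *)
Definition complex_elt (R : realType) (M T : Type) (I : finType)
    (g : I -> formfam R T) (b : T -> M) (c : {set I} -> formfam R M) :
    formfam R T :=
  fsum predT (fun S : {set I} =>
    fwedge (\big[@fwedge R T / @fone R T]_(i in S) g i) (pull b (c S))).

Definition in_complex (R : realType) (M : manifold R) (T : Type)
    (D : plots R T) (I : finType) (g : I -> formfam R T) (b : T -> M)
    (w : formfam R T) : Prop :=
  exists2 c : {set I} -> formfam R M, (forall S, is_form (@plot R M) (c S)) &
    eqon D w (complex_elt g b c).

(* [c] are the coefficients of an element of level at most [l]. *)
Definition level_le (R : realType) (M : manifold R) (I : finType) (l : nat)
    (c : {set I} -> formfam R M) : Prop :=
  forall S, is_form (@plot R M) (c S) /\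
    ((l < #|S|)%N -> eqon (@plot R M) (c S) (@fzero R M)).

Definition in_complex_level (R : realType) (M : manifold R) (T : Type)
    (D : plots R T) (I : finType) (g : I -> formfam R T) (b : T -> M) (l : nat)
    (w : formfam R T) : Prop :=
  exists2 c : {set I} -> formfam R M, level_le l c & eqon D w (complex_elt g b c).

(* Generating sets are indexed from 1; the values at 0 and beyond N are
   irrelevant. *)
Definition gens (R : realType) (T : Type) N (psi : nat -> formfam R T) :
  'I_N -> formfam R T := fun i => psi i.+1.

(* psi_1, ..., psi_N are given on E, each being pulled back from its E_j. *)
Fixpoint generating_set (R : realType) (M : manifold R) N (E : manifold R)
    (T : tower M N E) : (nat -> formfam R E) -> Prop :=
  match T in tower _ _ E return (nat -> formfam R E) -> Prop with
  | tower0 => fun _ => True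
  | towerS N' B E' k T' _ q => fun psi =>
      exists chi : nat -> formfam R B,
      [/\ generating_set T' chi,
          forall i, (1 <= i <= N')%N ->
            eqon (@plot R E') (psi i) (pull q (chi i)),
          global_angular_form q (psi N'.+1)
        & exists e : formfam R B,
          [/\ represents_euler_class q e,
              eqon (@plot R E') (fd (psi N'.+1)) (pull q e)
            & in_complex (@plot R B) (@gens R B N' chi) (tower_proj T') e]]
  end.

(* (E, Psi, H): a level-one N-iterated sphere bundle over M with a
   transgressive generating set and a level-one closed odd form. *)
Record level_one_triple (R : realType) (M : manifold R) (N : nat) :=
  LevelOneTriple {
  tot : manifold R;
  bundle : tower M N tot;
  proj := tower_proj bundle;
  psi : nat -> formfam R tot;
  flux : formfam R tot;
  psiP : generating_set bundle psi;
  psi_level_one : forall j, (1 <= j <= N)%N ->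
    in_complex_level (@plot R tot) (@gens R tot N psi) proj 1 (fd (psi j));
  flux_form : is_form (@plot R tot) flux;
  flux_odd : odd_form (@plot R tot) flux;
  flux_closed : closed_form (@plot R tot) flux;
  flux_level_one :
    in_complex_level (@plot R tot) (@gens R tot N psi) proj 1 flux
}.

Arguments proj {R M N} X : rename.
Arguments psi {R M N} X : rename.
Arguments flux {R M N} X : rename.

Definition psi0 (R : realType) (M : manifold R) N (X : level_one_triple M N)
  (i : nat) : formfam R (tot X) := if i is 0 then @fone R _ else psi X i.
Arguments psi0 {R M N} X i.

(* Matrices of forms on M are indexed by 0 <= i, j <= N + 1, and [A i j] is
   the entry with upper index i and lower index j. *)
Definition strict_upper_matrix (R : realType) (M : manifold R) (N : nat)
    (A : nat -> nat -> formfam R M) : Prop :=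
  forall i j, (i <= N.+1)%N -> (j <= N.+1)%N ->
    is_form (@plot R M) (A i j) /\
    ((j <= i)%N -> eqon (@plot R M) (A i j) (@fzero R M)).

Definition is_left_matrix (R : realType) (M : manifold R) N
    (X : level_one_triple M N) (A : nat -> nat -> formfam R M) : Prop :=
  [/\ strict_upper_matrix N A,
      forall j, (1 <= j <= N)%N -> eqon (@plot R (tot X)) (fd (psi X j))
        (fsum predT (fun i : 'I_j =>
           fwedge (psi0 X i) (pull (proj X) (A i j))))
    & eqon (@plot R (tot X)) (flux X)
        (fsum predT (fun i : 'I_N.+1 =>
           fwedge (psi0 X i) (pull (proj X) (A i N.+1))))].

Definition is_right_matrix (R : realType) (M : manifold R) N
    (X : level_one_triple M N) (A : nat -> nat -> formfam R M) : Prop :=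
  [/\ strict_upper_matrix N A,
      forall j, (1 <= j <= N)%N -> eqon (@plot R (tot X)) (fd (psi X j))
        (fsum predT (fun i : 'I_j =>
           fwedge (pull (proj X) (A (N.+1 - j)%N (N.+1 - i)%N))
                  (psi0 X i)))
    & eqon (@plot R (tot X)) (flux X)
        (fsum predT (fun i : 'I_N.+1 =>
           fwedge (pull (proj X) (A 0 (N.+1 - i)%N)) (psi0 X i)))].

(* P = diag(lam 0, ..., lam N.+1), and the last condition is
   Ahat = P^-1 A P entry by entry. *)
Definition reverse_dual_via (R : realType) (M : manifold R) N
    (X Y : level_one_triple M N) (lam : nat -> R) : Prop :=
  exists A Ahat : nat -> nat -> formfam R M,
  [/\ is_left_matrix X A, is_right_matrix Y Ahat,
      lam 0 = 1 /\ lam N.+1 = 1,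
      forall i, (1 <= i <= N)%N -> lam i != 0
    & forall i j, (i <= N.+1)%N -> (j <= N.+1)%N ->
        eqon (@plot R M) (Ahat i j) (fscale ((lam i)^-1 * lam j) (A i j))].

Definition reverse_dual (R : realType) (M : manifold R) N
    (X Y : level_one_triple M N) : Prop :=
  exists lam, reverse_dual_via X Y lam.

Definition unimodular_reverse_dual (R : realType) (M : manifold R) N
    (X Y : level_one_triple M N) : Prop :=
  exists2 lam, reverse_dual_via X Y lam &
    forall i, (1 <= i <= N)%N -> lam i = 1 \/ lam i = -1.

(* The plots of the fibre product, as a subspace of the product. *)
Definition fprod_plot (R : realType) (M E Ehat : manifold R)
    (f : E -> M) (fhat : Ehat -> M) : plots R (E * Ehat) :=
  fun n p => [/\ plot (fst \o p), plot (snd \o p)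
               & forall x, f (p x).1 = fhat (p x).2].

(* The family psi_1, ..., psi_N, psihat^1, ..., psihat^N on the fibre
   product, in this order. *)
Definition gens2 (R : realType) (M : manifold R) N
    (X Y : level_one_triple M N) (i : 'I_N + 'I_N) :
    formfam R (tot X * tot Y) :=
  match i with
  | inl i => pull fst (gens (psi X) i)
  | inr k => pull snd (gens (psi Y) k)
  end.

Arguments gens2 {R M N} X Y i.

(* v and vhat are given by their coordinates in the dual bases. *)
Definition nondegenerate_pairing (R : realType) N (Q : 'M[R]_N) : Prop :=
  (forall v : 'rV[R]_N,
     (forall vhat : 'rV[R]_N, (v *m Q *m vhat^T) 0 0 = 0) -> v = 0) /\
  (forall vhat : 'rV[R]_N,
     (forall v : 'rV[R]_N, (v *m Q *m vhat^T) 0 0 = 0) -> vhat = 0).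

Definition unimodular_matrix (R : realType) N (Q : 'M[R]_N) : Prop :=
  (forall i k, Q i k \is a Num.int) /\ (\det Q = 1 \/ \det Q = -1).

(* [Q] is the matrix of the bilinear map F(v, vhat): its entries are the
   degree-zero parts of the coefficients of psi_i psihat^k in F, which have to
   be constant functions on M. That F is a form need not be required, as
   [complex_elt] of forms is one. *)
Definition T_dual_via (R : realType) (M : manifold R) N
    (X Y : level_one_triple M N) (Q : 'M[R]_N) : Prop :=
  let D := fprod_plot (proj X) (proj Y) in
  exists (F : formfam R (tot X * tot Y))
         (c : {set 'I_N + 'I_N} -> formfam R M),
  [/\ level_le 2 c /\
        eqon D F (complex_elt (gens2 X Y) (fun e => proj X e.1) c),
      eqon D (fd F) (fsub (pull fst (flux X)) (pull snd (flux Y))),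
      forall (i k : 'I_N) n (p : 'rV[R]_n -> M), plot p ->
        forall x, c [set inl i; inr k]%SET n p x finset.set0 = Q i k
    & nondegenerate_pairing Q].

Definition T_dual (R : realType) (M : manifold R) N
    (X Y : level_one_triple M N) : Prop :=
  exists Q : 'M[R]_N, T_dual_via X Y Q.

Definition unimodular_T_dual (R : realType) (M : manifold R) N
    (X Y : level_one_triple M N) : Prop :=
  exists2 Q : 'M[R]_N, T_dual_via X Y Q & unimodular_matrix Q.

(* Main.v *)
(* The kernel of the duality is F = - sum_j lambda_j psi_j psihat^(N+1-j).
   The psi_j have odd degree, so d(psi_j psihat^(N+1-j)) is
   dpsi_j psihat^(N+1-j) - psi_j dpsihat^(N+1-j). With
   Ahat = P^-1 A P, each term lambda_j psi_i a^i_j psihat^(N+1-j) with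
   1 <= i < j <= N arises once from dpsi_j and once, with the opposite sign,
   from dpsihat^(N+1-i). What survives has i = 0 or j = N + 1: these are the terms
   of Hhat and H, apart from the common a^0_(N+1), which cancels in H - Hhat.
   The pairing is antidiagonal with entries - lambda_j. *)
Require Import Defs.
From HB Require Import structures.
From mathcomp Require Import all_boot all_order all_algebra perm.
From mathcomp Require Import all_classical all_reals all_analysis.
From mathcomp Require Import fintype finset ring zify.

Set Implicit Arguments.
Unset Strict Implicit.
Unset Printing Implicit Defensive.

Import Order.TTheory GRing.Theory Num.Theory.
Import numFieldNormedType.Exports.

(** * Signs and products in the exterior algebra of one coordinate space *)

Section ExteriorAlgebra.
Local Open Scope ring_scope.
Variables (R : realType) (n : nat).
Implicit Types (a b c : ext R n) (i : 'I_n) (I J K L : {set 'I_n}).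

(** Turning the inversion count into a product over pairs makes the sign multiplicative in each
    argument over disjoint unions. *)
Lemma esign_prod I J :
  esign R I J = \prod_(i in I) \prod_(j in J) (-1) ^+ (j < i)%N.
Proof.
rewrite /esign -prodr_const pair_big /=.
rewrite (eq_bigl (fun p : 'I_n * 'I_n =>
  ((p.1 \in I) && (p.2 \in J)) && (p.2 < p.1)%N)); last first.
  by move=> p; rewrite inE -andbA.
rewrite big_mkcondr; apply: eq_bigr => p _.
by case: ifP; rewrite ?expr1 ?expr0.
Qed.

Lemma esignUl I J L : [disjoint I & J] ->
  esign R (I :|: J) L = esign R I L * esign R J L.
Proof.
move=> dIJ; rewrite !esign_prod -bigU //=.
by apply: eq_bigl => i; rewrite !inE.
Qed.

Lemma esignUr I J L : [disjoint J & L] ->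
  esign R I (J :|: L) = esign R I J * esign R I L.
Proof.
move=> dJL; rewrite !esign_prod -big_split; apply: eq_bigr => i _ /=.
by rewrite -bigU //=; apply: eq_bigl => j; rewrite !inE.
Qed.

(** For each [j] in [J], exactly one of the two orders of [i] and [j] is an inversion, so the two
    signs differ by one factor -1 per element of [J]. *)
Lemma esign_set1C i J : i \notin J ->
  esign R [set i] J = (-1) ^+ #|J| * esign R J [set i].
Proof.
move=> iJ; rewrite !esign_prod big_set1 -prodr_const -big_split /=.
apply: eq_bigr => j jJ; rewrite big_set1.
have : j != i by apply: contraNneq iJ => <-.
by rewrite neq_ltn => /orP[] h; rewrite h ltnNge (ltnW h) /=;
  ring.
Qed.

(** Both sides sum over the splittings of [K] into three disjoint parts, and by [esignUl] and
    [esignUr] both signs are the product of the three pairwise signs. *)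
Lemma ewedgeA a b c : ewedge (ewedge a b) c = ewedge a (ewedge b c).
Proof.
apply/funext => K; rewrite /ewedge.
under eq_bigr => S _.
  rewrite mulr_sumr mulr_suml.
  over.
rewrite (exchange_big_dep (fun I : {set 'I_n} => I \subset K)) /=; last first.
  by move=> S I SK IS; apply: subset_trans IS SK.
apply: eq_bigr => I IK; rewrite mulr_sumr.
(* The first two parts together form [S]; the middle one is recovered as [S :\: I]. *)
rewrite (reindex_onto (fun J => I :|: J) (fun S => S :\: I)) /=; last first.
  by move=> S /andP[_ IS]; rewrite setDE setUIr setUCr setIT; apply/setUidPr.
apply: eq_big => [J|J /andP[/andP[UK _] /eqP UJ]].
  rewrite subUset IK subsetUl andbT /= subsetD; congr (_ && _).
  by rewrite setDUl setDv set0U; apply/eqP/idP => /setDidPl.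
have dIJ : [disjoint I & J].
  by rewrite -UJ -setI_eq0 setIDA [I :&: _]setIC -setIDA setDv setI0.
rewrite UJ setDDl.
have -> : K :\: I = J :|: (K :\: (I :|: J)).
  apply/setP => x; rewrite !inE; have [xJ|] := boolP (x \in J); last by rewrite orbF.
  rewrite /=; move: dIJ; rewrite disjoint_sym => /disjointFr/(_ xJ) -> /=.
  by move/subsetP: UK; apply; rewrite inE xJ orbT.
rewrite esignUl // esignUr; last first.
  by rewrite -setI_eq0; apply/eqP/setP => x; rewrite !inE;
  case: (x \in J); rewrite ?orbT ?andbF.
by ring.
Qed.

Lemma ewedge1r a : ewedge a (@eone R n) = a.
Proof.
apply/funext => K; rewrite /ewedge (bigD1 K) //= big1 ?addr0.
  by rewrite setDv /eone eqxx mulr1 esign_prod big1 ?mul1r // => i _; rewrite big_set0.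
move=> I /andP[IK nIK]; rewrite /eone setD_eq0.
have [KI|_] := boolP (K \subset I); last by rewrite mulr0.
by case/eqP: nIK; apply/eqP; rewrite eqEsubset IK.
Qed.

Lemma ewedge1l a : ewedge (@eone R n) a = a.
Proof.
apply/funext => K; rewrite /ewedge (bigD1 set0) ?sub0set //= big1 ?addr0.
  by rewrite setD0 /eone eqxx mulr1 esign_prod big_set0 mul1r.
by move=> I /andP[_ /negPf nI]; rewrite /eone nI mulr0 mul0r.
Qed.

Lemma ewedge_suml (T : Type) (r : seq T) (P : pred T) (a : T -> ext R n) b K :
  ewedge (fun S => \sum_(t <- r | P t) a t S) b K =
  \sum_(t <- r | P t) ewedge (a t) b K.
Proof.
rewrite /ewedge exchange_big; apply: eq_bigr => I _.
by rewrite mulr_sumr mulr_suml.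
Qed.

Lemma ewedge_sumr (T : Type) (r : seq T) (P : pred T) (a : T -> ext R n) b K :
  ewedge b (fun S => \sum_(t <- r | P t) a t S) K =
  \sum_(t <- r | P t) ewedge b (a t) K.
Proof.
rewrite /ewedge exchange_big; apply: eq_bigr => I _.
by rewrite mulr_sumr.
Qed.

Lemma ewedgeZl (s : R) a b K :
  ewedge (fun S => s * a S) b K = s * ewedge a b K.
Proof. by rewrite /ewedge mulr_sumr; apply: eq_bigr => I _; ring. Qed.

Lemma ewedgeZr (s : R) a b K :
  ewedge a (fun S => s * b S) K = s * ewedge a b K.
Proof. by rewrite /ewedge mulr_sumr; apply: eq_bigr => I _; ring. Qed.

Definition edx i : ext R n := fun K => (K == [set i])%:R.

Lemma ewedge_edxl i b K :
  ewedge (edx i) b K =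
  if i \in K then esign R [set i] (K :\ i) * b (K :\ i) else 0.
Proof.
rewrite /ewedge /edx; case: ifP => iK.
  rewrite (bigD1 [set i]) ?sub1set //= big1 ?addr0 ?eqxx ?mulr1 //.
  by move=> I /andP[_ /negPf ->]; rewrite mulr0 mul0r.
rewrite big1 // => I IK; case: eqP IK => [->|]; rewrite ?mulr0 ?mul0r //.
by rewrite sub1set iK.
Qed.

Lemma ewedge_edxr i a K :
  ewedge a (edx i) K =
  if i \in K then esign R (K :\ i) [set i] * a (K :\ i) else 0.
Proof.
rewrite /ewedge /edx; case: ifP => iK.
  rewrite (bigD1 (K :\ i)) ?subD1set //= big1 ?addr0.
    by rewrite setDDr setDv set0U (setIidPr _) ?sub1set // eqxx mulr1.
  move=> I /andP[IK nI]; case: eqP => [KI|]; rewrite ?mulr0 //.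
  by case/eqP: nI; rewrite -KI setDDr setDv set0U; apply/esym/setIidPr.
rewrite big1 // => I IK; case: eqP => [KI|]; rewrite ?mulr0 //.
have : i \in K :\: I by rewrite KI set11.
by rewrite inE iK andbF.
Qed.

(** Parity is recorded instead of a degree because the sign in the Leibniz rule depends on parity
    alone. *)
Definition odd_ext a := forall K, ~~ odd #|K| -> a K = 0.

Lemma edx_odd_extC i a : odd_ext a ->
  forall K, ewedge (edx i) a K = - ewedge a (edx i) K.
Proof.
move=> oa K; rewrite ewedge_edxl ewedge_edxr; case: ifP; rewrite ?oppr0 //.
move=> iK; have [oK|/oa ->] := boolP (odd #|K :\ i|); last by rewrite !mulr0 oppr0.
by rewrite esign_set1C ?setD11 // -signr_odd oK expr1; ring.
Qed.

(** * The exterior derivative in coordinates and its Leibniz rule *)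

Implicit Types u v : 'rV[R]_n -> ext R n.

(** This is [fd] on a fixed plot, so the two agree by conversion; it also applies to functions that
    do not come from a form on a space. *)
Definition ed u x : ext R n := fun K =>
  \sum_(i in K) esign R [set i] (K :\ i) * partial i (fun y => u y (K :\ i)) x.

Lemma edE u x K :
  ed u x K = \sum_i ewedge (edx i) (fun S => partial i (fun y => u y S) x) K.
Proof.
rewrite /ed big_mkcond; apply: eq_bigr => i _.
by rewrite ewedge_edxl.
Qed.

Definition derivable_ext u x :=
  forall i K, derivable (fun y => u y K) x (delta_mx 0 i).

Lemma is_derive_big (T : Type) (r : seq T) (P : pred T)
    (f : T -> 'rV[R]_n -> R) x (h : 'rV[R]_n) :
  (forall t, derivable (f t) x h) ->
  is_derive x h (fun y => \sum_(t <- r | P t) f t y)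
                (\sum_(t <- r | P t) 'D_h (f t) x).
Proof.
move=> df; elim: r => [|t r IH].
  rewrite big_nil (_ : (fun _ => _) = cst 0); first exact: is_derive_cst.
  by apply/funext => y; rewrite big_nil.
rewrite big_cons; case: (boolP (P t)) => Pt.
  rewrite (_ : (fun _ => _) = f t + (fun y => \sum_(t <- r | P t) f t y)).
    by apply: is_deriveD; apply: derivableP.
  by apply/funext => y; rewrite big_cons Pt.
rewrite (_ : (fun _ => _) = (fun y => \sum_(t <- r | P t) f t y)) //.
by apply/funext => y; rewrite big_cons (negPf Pt).
Qed.

Lemma is_derive_ewedge u v x i K : derivable_ext u x -> derivable_ext v x ->
  is_derive x (delta_mx 0 i) (fun y => ewedge (u y) (v y) K)
    (ewedge (fun S => partial i (fun y => u y S) x) (v x) K +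
     ewedge (u x) (fun S => partial i (fun y => v y S) x) K).
Proof.
move=> du dv; rewrite /ewedge -big_split /=.
have dM I J s : is_derive x (delta_mx 0 i) (fun y => s * u y I * v y J)
   (s * partial i (fun y => u y I) x * v x J +
    s * u x I * partial i (fun y => v y J) x).
  have := is_deriveM (is_deriveZ s (derivableP (du i I))) (derivableP (dv i J)).
  move/is_derive_eq; apply.
  by rewrite /partial /GRing.scale /= -[s *: u x I]/(s * u x I); ring.
pose f I y := esign R I (K :\: I) * u y I * v y (K :\: I).
have /= := @is_derive_big _ (index_enum _) (fun I => I \subset K) f x (delta_mx 0 i).
move=> /(_ (fun I => @ex_derive _ _ _ _ _ _ _ (dM _ _ _))) /is_derive_eq; apply.
by apply: eq_bigr => I _; rewrite derive_val.
Qed.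

(** With d written as the sum of dx_i times the i-th partial derivative, the product rule for each
    partial gives two terms; moving dx_i past the odd [u x] in the second produces the minus
    sign. *)
Lemma ed_ewedge u v x K : odd_ext (u x) ->
    derivable_ext u x -> derivable_ext v x ->
  ed (fun y => ewedge (u y) (v y)) x K =
  ewedge (ed u x) (v x) K - ewedge (u x) (ed v x) K.
Proof.
move=> ou du dv; rewrite edE.
rewrite (funext (edE u x)) (funext (edE v x)) ewedge_suml ewedge_sumr -sumrB.
apply: eq_bigr => i _; rewrite ewedgeA -(ewedgeA (u x)).
have -> : ewedge (u x) (edx i) = fun S => -1 * ewedge (edx i) (u x) S.
  by apply/funext => S; rewrite edx_odd_extC //; ring.
rewrite ewedgeZl ewedgeA mulN1r opprK.
rewrite !ewedge_edxl; case: ifP => iK; rewrite ?addr0 // -mulrDr.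
congr (_ * _); have H := is_derive_ewedge i (K :\ i) du dv.
exact: derive_val.
Qed.

End ExteriorAlgebra.

(** * Linearity of [ed], constant forms, and the finite sums behind the cancellation *)

Section ReverseDuality.
Local Open Scope ring_scope.
Variable R : realType.

Lemma ed_lincomb n (T : Type) (r : seq T) (s : T -> R)
    (u : T -> 'rV[R]_n -> ext R n) x K :
  (forall t, derivable_ext (u t) x) ->
  ed (fun y S => \sum_(t <- r) s t * u t y S) x K =
  \sum_(t <- r) s t * ed (u t) x K.
Proof.
move=> du; rewrite /ed; under [RHS]eq_bigr do rewrite mulr_sumr.
rewrite exchange_big; apply: eq_bigr => i _ /=.
have ds t := is_deriveZ (s t) (derivableP (du t i (K :\ i))).
have /= H := @is_derive_big _ _ _ r xpredT
  (fun t y => s t * u t y (K :\ i)) x (delta_mx 0 i)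
  (fun t => @ex_derive _ _ _ _ _ _ _ (ds t)).
rewrite /partial derive_val mulr_sumr; apply: eq_bigr => t _.
by rewrite (@derive_val _ _ _ _ _ _ _ (ds t)) /GRing.scale /=; ring.
Qed.

Lemma smooth_on_cst n (U : set 'rV[R]_n) (t : R) : smooth_on U (fun=> t).
Proof.
move=> k; elim: k t => [|k IH] t /=; split => //; try by move=> x _; exact: cst_continuous.
move=> i; split=> [x _|]; first exact: derivable_cst.
rewrite (_ : partial i _ = fun=> 0) //.
by apply/funext => x; rewrite /partial derive_cst.
Qed.

(** The coefficients of the duality kernel are constants. Under pullback only the empty index set
    contributes, with an empty product of differentials. *)
Lemma is_form_scalar (T : Type) (D : plots R T) (t : R) :
  is_form D (fscale t (@fone R T)).
Proof.
split=> [n p _ K|m n p g _ _ x];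
  first exact: (@smooth_on_cst _ _ (t * @eone R n K)).
apply/funext => K; rewrite /epull /fscale /fone (bigD1 set0) //= big1 ?addr0.
  by rewrite big_set0 /eone eqxx mulr1.
by move=> I /negPf nI; rewrite /eone nI mulr0 mul0r.
Qed.

(** No law is assumed on [op], so the order of enumeration matters: a sum type lists its left
    summand first, which puts psi_i before psihat^k in the kernel. *)
Lemma big_set_inl_inr (T : Type) (op : T -> T -> T) (idx : T) (I J : finType)
    (i : I) (j : J) (g : I + J -> T) :
  \big[op/idx]_(e in [set inl i; inr j]) g e =
  op (g (inl i)) (op (g (inr j)) idx).
Proof.
rewrite -big_filter.
suff -> : [seq e <- index_enum (I + J)%type | e \in [set inl i; inr j]] =
    [:: inl i; inr j].
  by rewrite unlock.
have sumE : Finite.enum (I + J)%type = sum_enum I J by rewrite [in LHS]unlock.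
rewrite [index_enum _]unlock sumE filter_cat !filter_map.
rewrite (@eq_filter _ _ (pred1 i)); last by move=> k; rewrite !inE /= orbF.
rewrite (@eq_filter _ (preim inr _) (pred1 j)); last by move=> k; rewrite !inE.
by rewrite !filter_pred1_uniq // -?enumT ?enum_uniq ?mem_enum.
Qed.

Lemma pair_inl_inr_eq (I J : finType) (i i' : I) (j j' : J) :
  ([set inl i; inr j] == [set inl i'; inr j'] :> {set I + J}) =
  (i == i') && (j == j').
Proof.
apply/eqP/andP => [/setP E|[/eqP-> /eqP->] //].
have := E (inl i); have := E (inr j); rewrite !inE !eqxx /= orbF.
by move=> /esym/eqP[->] /esym/eqP[->].
Qed.

(** The entries with 1 <= i < j <= N occur in both double sums, once by columns and once by rows;
    row 0 and column N + 1 remain, and the corner occurs in neither sum. *)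
Lemma sum_triangle_cancel (V : zmodType) (G : nat -> nat -> V) N :
  \sum_(1 <= j < N.+1) (\sum_(0 <= i < j) G i j - \sum_(j.+1 <= k < N.+2) G j k)
  = \sum_(1 <= j < N.+1) G 0%N j - \sum_(1 <= j < N.+1) G j N.+1.
Proof.
rewrite sumrB.
have -> : \sum_(1 <= j < N.+1) \sum_(0 <= i < j) G i j =
   \sum_(1 <= j < N.+1) G 0%N j +
   \sum_(1 <= j < N.+1) \sum_(1 <= i < N.+1 | (i < j)%N) G i j.
  rewrite -big_split; apply: eq_big_nat => j /andP[j0 jN].
  rewrite big_ltn //=; congr (_ + _).
  by rewrite (big_nat_widen _ _ N.+1) //; exact: ltnW.
have -> : \sum_(1 <= j < N.+1) \sum_(j.+1 <= k < N.+2) G j k =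
   \sum_(1 <= j < N.+1) G j N.+1 +
   \sum_(1 <= j < N.+1) \sum_(1 <= k < N.+1 | (j < k)%N) G j k.
  rewrite -big_split; apply: eq_big_nat => j /andP[j0 jN].
  rewrite big_nat_recr //= addrC; congr (_ + _).
  by rewrite (big_nat_widenl _ 1) //=; apply: eq_bigl => k; rewrite andTb.
rewrite [X in _ - (_ + X)](exchange_big_dep_nat xpredT) //=.
by rewrite opprD addrACA subrr addr0.
Qed.

(** The substitution k = N + 1 - i undoes the index reversal in the right matrix. *)
Lemma sum_ord_rev (V : zmodType) (f : nat -> V) N j : (j <= N)%N ->
  \sum_(i < N.+1 - j) f (N.+1 - i)%N = \sum_(j.+1 <= k < N.+2) f k.
Proof.
move=> jN; rewrite -(add0n j.+1) big_addn subSS big_nat_rev /= big_mkord.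
by apply: eq_bigr => i _; congr f; have := ltn_ord i; lia.
Qed.

(** This is dF = H - Hhat evaluated at one point of a plot, as pure algebra: [du] and [dv] are
    arbitrary elements obeying the structure equations. *)
Lemma reverse_dual_cancel n N (lam : nat -> R) (u v du dv : nat -> ext R n)
    (A B : nat -> nat -> ext R n) K :
  u 0%N = @eone R n -> v 0%N = @eone R n -> lam 0%N = 1 -> lam N.+1 = 1 ->
  (forall j, (1 <= j <= N)%N -> lam j != 0) ->
  (forall i j, (i <= N.+1)%N -> (j <= N.+1)%N ->
    B i j = fun S => (lam i)^-1 * lam j * A i j S) ->
  (forall j, (1 <= j <= N)%N ->
    du j = fun S => \sum_(i < j) ewedge (u i) (A i j) S) ->
  (forall j, (1 <= j <= N)%N ->
    dv j = fun S => \sum_(i < j) ewedge (B (N.+1 - j)%N (N.+1 - i)%N) (v i) S) ->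
  \sum_(j < N) - lam j.+1 *
    (ewedge (du j.+1) (v (N - j)%N) K - ewedge (u j.+1) (dv (N - j)%N) K) =
  \sum_(i < N.+1) ewedge (u i) (A i N.+1) K -
  \sum_(i < N.+1) ewedge (B 0%N (N.+1 - i)%N) (v i) K.
Proof.
move=> u0 v0 l0 lN lam_neq0 BA duE dvE.
(* The common shape lambda_j psi_i a^i_j psihat^(N+1-j) of all terms, from either differential. *)
pose G i j := lam j * ewedge (u i) (ewedge (A i j) (v (N.+1 - j)%N)) K.
transitivity (- \sum_(1 <= j < N.+1)
    (\sum_(0 <= i < j) G i j - \sum_(j.+1 <= k < N.+2) G j k)).
  rewrite (big_addn 0 _ 1) subn1 /= big_mkord -sumrN; apply: eq_bigr => j _.
  rewrite addn1 mulNr; congr (- _); rewrite mulrBr; have jN := ltn_ord j; congr (_ - _).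
    rewrite duE //.
    rewrite ewedge_suml mulr_sumr big_mkord; apply: eq_bigr => i _.
    by rewrite ewedgeA.
  rewrite dvE; last by lia.
  rewrite (_ : N.+1 - (N - j) = j.+1)%N; last by lia.
  rewrite ewedge_sumr mulr_sumr -sum_ord_rev //.
  apply: eq_bigr => i _; have iN := ltn_ord i; rewrite /G.
  rewrite (_ : N.+1 - (N.+1 - i) = i)%N; last by lia.
  have -> : ewedge (B j.+1 (N.+1 - i)%N) (v i) =
      fun S => (lam j.+1)^-1 * lam (N.+1 - i)%N * ewedge (A j.+1 (N.+1 - i)%N) (v i) S.
    by apply/funext => S; rewrite BA ?leq_subr ?ltnS 1?ltnW // ewedgeZl.
  (* The factor lambda_(j+1) of the kernel cancels its inverse in Ahat, leaving the weight lambda_k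
     of the column k = N + 1 - i, as [G] requires. *)
  by rewrite ewedgeZr !mulrA divff ?lam_neq0 // !mul1r.
rewrite sum_triangle_cancel opprB.
have -> : \sum_(i < N.+1) ewedge (u i) (A i N.+1) K = \sum_(0 <= i < N.+1) G i N.+1.
  by rewrite big_mkord; apply: eq_bigr => i _; rewrite /G lN subnn v0 ewedge1r mul1r.
have -> : \sum_(i < N.+1) ewedge (B 0 (N.+1 - i)%N) (v i) K =
    \sum_(1 <= j < N.+2) G 0%N j.
  rewrite -sum_ord_rev // subn0; apply: eq_bigr => i _.
  rewrite BA ?leq_subr // l0 invr1 mul1r ewedgeZl /G u0 ewedge1l.
  by rewrite (_ : N.+1 - (N.+1 - i) = i)%N //; have := ltn_ord i; lia.
(* The corner [G 0 N.+1], which is a^0_(N+1), ends one sum and begins the other. *)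
rewrite (big_nat_recr N.+1) /= 1?addrC; last by [].
by rewrite [in RHS](big_ltn (ltn0Sn N)) opprD addrACA subrr add0r.
Qed.

(** * Generators on iterated sphere bundles, antidiagonal pairings, and the duality *)

Variable M : manifold R.

Lemma tower_proj_smooth N E (T : tower M N E) : smooth_mfd_map (tower_proj T).
Proof.
elim: T => [|N' B E' k T' IH _ q] n p plp //=.
exact: (IH _ _ (sb_smooth q plp)).
Qed.

(** Induction up the tower: the top generator is smooth and homogeneous of the odd fibre degree, and
    on a plot [p] a lower one takes the values of its original on [q \o p]. *)
Lemma generator_odd_derivable N E (T : tower M N E) (psi : nat -> formfam R E) :
  generating_set T psi -> forall j, (1 <= j <= N)%N ->
  forall n (p : 'rV[R]_n -> E), plot p -> forall x,
  odd_ext (psi j n p x) /\ derivable_ext (psi j n p) x.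
Proof.
elim: T psi => [|N' B E' k T' IH odd_k q] psi /=; first by move=> _ [].
move=> [chi [gchi psi_chi [fpsi hpsi _] _]] j /andP[j0 jN] n p plp x.
have [jN'|] := leqP j N'.
  have -> : psi j n p = chi j n (q \o p).
    by apply/funext => y; apply: psi_chi => //; rewrite j0.
  by apply: IH; rewrite ?j0 //; exact: sb_smooth.
move=> N'j; have -> : j = N'.+1 by lia.
split=> [K oK|i K]; first by apply: (hpsi _ _ plp); apply: contraNneq oK => ->.
by have [_ /(_ i) [+ _]] := fpsi.1 _ _ plp K 1%N; exact.
Qed.

Definition antidiag_mx N (s : 'I_N -> R) : 'M[R]_N :=
  \matrix_(i, k) ((k == rev_ord i)%:R * s i).

(** The matrix is a diagonal matrix times the permutation matrix of [rev_ord]. The sign stays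
    unspecified, which suffices for invertibility and for determinant 1 or -1. *)
Lemma det_antidiag N (s : 'I_N -> R) :
  exists b : bool, \det (antidiag_mx s) = (-1) ^+ b * \prod_i s i.
Proof.
exists (odd_perm (perm (@rev_ord_inj N))).
have -> : antidiag_mx s =
    diag_mx (\row_i s i) *m perm_mx (perm (@rev_ord_inj N)).
  by apply/matrixP => i k; rewrite mul_diag_mx !mxE permE eq_sym mulrC.
rewrite det_mulmx det_diag det_perm mulrC; congr (_ * _).
by apply: eq_bigr => i _; rewrite mxE.
Qed.

(** A vector orthogonal to all basis vectors vanishes; applied to [v *m Q] and to [v *m Q^T], this
    leaves only to cancel an invertible matrix. *)
Lemma unitmx_nondegenerate N (Q : 'M[R]_N) :
  Q \in unitmx -> nondegenerate_pairing Q.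
Proof.
move=> uQ; have dot0 (w : 'rV[R]_N) : (forall z : 'rV_N, (w *m z^T) 0 0 = 0) -> w = 0.
  move=> w0; apply/rowP => i; have := w0 (delta_mx 0 i).
  by rewrite trmx_delta -colE !mxE.
split=> [v v0|v v0].
  by rewrite -[v](mulmxK uQ) (dot0 _ v0) mul0mx.
suff : v *m Q^T = 0.
  by move=> vQ; rewrite -[v](@mulmxK _ _ _ Q^T) ?unitmx_tr // vQ mul0mx.
apply: dot0 => z; rewrite -(v0 z) -[in RHS]mulmxA.
by rewrite -[in RHS](trmxK (z *m _)) [in RHS]mxE !trmx_mul trmxK.
Qed.

Lemma reverse_dual_T_dual N (X Y : level_one_triple M N) (lam : nat -> R) :
  reverse_dual_via X Y lam ->
  T_dual_via X Y (antidiag_mx (fun i => - lam i.+1)).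
Proof.
move=> [A [B [[_ dX HX] [_ dY HY] [l0 lN] lam_neq0 BA]]].
pose s (i : 'I_N) := - lam i.+1.
(* The coefficient is - lambda_(i+1) on the pair psi_(i+1), psihat^(N-i), since generators are
   numbered from 1, and zero on every other set. *)
pose c (S : {set 'I_N + 'I_N}) : formfam R M :=
  fscale (\sum_i (S == [set inl i; inr (rev_ord i)])%:R * s i) (@fone R M).
pose F := complex_elt (gens2 X Y) (fun e => Defs.proj X e.1) c.
have FE n p (x : 'rV[R]_n) K : F n p x K = \sum_i s i *
    ewedge (psi X i.+1 n (fst \o p) x) (psi Y (N - i)%N n (snd \o p) x) K.
  rewrite /F /complex_elt /fsum /c.
  under eq_bigr do rewrite /fwedge /pull /fscale /fone ewedgeZr ewedge1r mulr_suml.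
  rewrite exchange_big; apply: eq_bigr => i _ /=.
  rewrite (bigD1 [set inl i; inr (rev_ord i)]) //= big1 ?addr0; last first.
    by move=> S /negPf ->; rewrite !mul0r.
  rewrite eqxx mul1r big_set_inl_inr /fwedge /fone ewedge1r /= /pull /gens /=.
  by rewrite subnSK.
exists F, c; split.
- split=> // S; split=> [|S2]; first exact: is_form_scalar.
  move=> n p _ x; apply/funext => K; rewrite /c /fscale big1 ?mul0r // => i _.
  by case: eqP S2 => [->|]; rewrite ?mul0r // cards2.
- move=> n p [plX plY fib] x; apply/funext => K.
  have oX j : (1 <= j <= N)%N -> _ :=
    fun h => generator_odd_derivable (psiP X) h plX x.
  have oY j : (1 <= j <= N)%N -> _ :=
    fun h => generator_odd_derivable (psiP Y) h plY x.
  have -> : fd F p x = ed (F n p) x by [].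
  have -> : F n p = fun y K => \sum_i s i *
      ewedge (psi X i.+1 n (fst \o p) y) (psi Y (N - i)%N n (snd \o p) y) K.
    by apply/funext => y; apply/funext => S; exact: FE.
  rewrite ed_lincomb; last first.
    move=> i k S; have iN := ltn_ord i.
    apply: (@ex_derive _ _ _ _ _ _ _ (is_derive_ewedge _ _ _ _)).
      by apply: (oX _ _).2.
    by apply: (oY _ _).2; lia.
  (* On the fibre product both projections to M agree, so the entries of both matrices are evaluated
     on one plot of M. *)
  have projE : Defs.proj Y \o (snd \o p) = Defs.proj X \o (fst \o p).
    by apply/funext => y; rewrite /= fib.
  have plM : plot (Defs.proj X \o (fst \o p)) by exact: tower_proj_smooth.
  rewrite /fsub /pull HX // HY //.
  have := @reverse_dual_cancel n N lam
    (fun i => psi0 X i n (fst \o p) x) (fun i => psi0 Y i n (snd \o p) x)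
    (fun i => fd (psi X i) (fst \o p) x) (fun i => fd (psi Y i) (snd \o p) x)
    (fun i j => A i j n (Defs.proj X \o (fst \o p)) x)
    (fun i j => B i j n (Defs.proj X \o (fst \o p)) x) K.
  move=> /(_ erefl erefl l0 lN lam_neq0) H.
  rewrite /fsum /fwedge /pull projE -H; last 3 first.
  + by move=> i j iN jN; rewrite BA.
  + by move=> j jN; rewrite dX.
  + by move=> j jN; rewrite dY //; rewrite /fsum /fwedge /pull projE.
  apply: eq_bigr => i _; have iN := ltn_ord i.
  (* Since i < N, the index N - i is positive and avoids the value 1 of [psi0] at 0. *)
  have -> : psi0 Y (N - i)%N = psi Y (N - i)%N
    by case: (N - i)%N (subn_gt0 i N); rewrite iN.
  rewrite ed_ewedge //; first exact: (oX _ _).1.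
    exact: (oX _ _).2.
  by apply: (oY _ _).2; lia.
- move=> i k n p _ x; rewrite /c /fscale /fone /eone eqxx mulr1 mxE.
  rewrite (bigD1 i) //= big1 ?addr0; last first.
    by move=> j; rewrite pair_inl_inr_eq eq_sym => /negPf ->; rewrite mul0r.
  by rewrite pair_inl_inr_eq eqxx.
- apply: unitmx_nondegenerate; rewrite unitmxE unitfE.
  have [b ->] := det_antidiag (fun i : 'I_N => - lam i.+1).
  rewrite mulf_neq0 ?signr_eq0 //; apply/prodf_neq0 => i _.
  by rewrite oppr_eq0 lam_neq0 //=.
Qed.

(** The determinant is a sign times a product of signs. *)
Lemma antidiag_unimodular N (s : 'I_N -> R) :
  (forall i, s i = 1 \/ s i = -1) -> unimodular_matrix (antidiag_mx s).
Proof.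
move=> s1; split=> [i k|].
  by rewrite mxE; case: (s1 i) => ->; rewrite ?rpredM ?rpredN ?rpred1 ?rpred_nat.
have [b ->] := det_antidiag s.
have : \prod_i s i = 1 \/ \prod_i s i = -1.
  elim/big_ind: _ => [|x y|i _]; [by left| |exact: s1].
  by move=> [->|->] [->|->]; rewrite ?mulrNN ?mulr1 ?mul1r; auto.
by case: b => [][]->; rewrite ?expr1 ?expr0 ?mulrNN ?mulr1 ?mul1r; auto.
Qed.

End ReverseDuality.

Theorem theorem5p3 (R : realType) (M : manifold R) (N l : nat)
    (X Y : level_one_triple M N) :
  homogeneous (@plot R (tot X)) (l.*2).+1 (flux X) ->
  integral_class (l.*2) (flux X) ->
  (reverse_dual X Y -> T_dual X Y) /\
  (unimodular_reverse_dual X Y -> unimodular_T_dual X Y).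
Proof.
move=> _ _; split=> [[lam XY]|[lam XY lam1]].
  by exists (antidiag_mx (fun i => (- lam i.+1)%R)); exact: reverse_dual_T_dual.
exists (antidiag_mx (fun i => (- lam i.+1)%R)); first exact: reverse_dual_T_dual.
apply: antidiag_unimodular => i.
by case: (lam1 i.+1) => [|->|->] //=; rewrite ?opprK; auto.
Qed.
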